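(* Let $\mathfrak{g}$ be a complex simple Lie algebra of rank $r$ with root system $\Phi$, positive roots $\Phi_+$, Chevalley involution $\omega$, and fix-point Lie subalgebra $\mathfrak{k}=\{x\in\mathfrak{g}\mid\omega(x)=x\}$. Let $\{h_i,e_\alpha\}_{1\le i\le r,\alpha\in\Phi}$ be a Chevalley basis of $\mathfrak{g}$ with $\omega(e_\alpha)=-e_{-\alpha}$ for all $\alpha\in\Phi$, let $\mathfrak{g}_{\mathbb{Z}}$ be its $\mathbb{Z}$-span, and put $y_\alpha:=e_\alpha-e_{-\alpha}$ for $\alpha\in\Phi$. Then $$\mathfrak{k}_{\mathbb{Z}}:=\{x\in\mathfrak{g}_{\mathbb{Z}}\mid\omega(x)=x\}$$ is an integral form of $\mathfrak{k}$ with $\mathbb{Z}$-basis $\{y_\alpha\}_{\alpha\in\Phi_+}$. The structure constants of $\mathfrak{k}_{\mathbb{Z}}$ with respect to $\{y_\alpha\}_{\alpha\in\Phi_+}$ are given by $$[y_\alpha,y_\beta]=\kappa_{\alpha,\beta}\,y_{\alpha+\beta}-\kappa_{\alpha,-\beta}\,y_{\alpha-\beta}\qquad(\alpha,\beta\in\Phi_+,\ \alpha\neq\beta),$$ where a term on the right hand side is read as $0$ when $\alpha+\beta\notin\Phi$, respectively $\alpha-\beta\notin\Phi$.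
   Context: Fix a Cartan subalgebra $\mathfrak{h}\subset\mathfrak{g}$, the root system $\Phi\subset\mathfrak{h}^*$, positive roots $\Phi_+$ and simple roots $\alpha_1,\ldots,\alpha_r$. Let $(\cdot,\cdot)$ be the nondegenerate invariant symmetric bilinear form on $\mathfrak{g}$ (normalized so that $(\alpha,\alpha)=2$ for long roots for the induced form on $\mathfrak{h}^*$), let $t_\alpha\in\mathfrak{h}$ be defined by $(t_\alpha,h)=\alpha(h)$ for $h\in\mathfrak h$, $h_\alpha:=2t_\alpha/(\alpha,\alpha)$, and $h_i:=h_{\alpha_i}$. Fix $e_i\in\mathfrak{g}_{\alpha_i}$, $f_i\in\mathfrak{g}_{-\alpha_i}$ with $[e_i,f_i]=h_i$. The Chevalley involution $\omega$ is the involutive automorphism of $\mathfrak{g}$ with $\omega|_{\mathfrak{h}}=-\mathrm{Id}_{\mathfrak h}$ and $\omega(e_i)=-f_i$. The Chevalley basis is chosen with $e_{\alpha_i}=e_i$, $e_{-\alpha_i}=f_i$, $e_\alpha\in\mathfrak{g}_\alpha$, $[e_\alpha,e_{-\alpha}]=h_\alpha$ and $\omega(e_\alpha)=-e_{-\alpha}$. The $\mathbb{Z}$-module $\mathfrak{g}_{\mathbb{Z}}=\mathrm{span}_{\mathbb{Z}}\{e_\alpha,h_i\}$ is a ($\omega$-stable) integral form of $\mathfrak{g}$. Here an integral form of a complex Lie algebra $\mathfrak{a}$ is a $\mathbb{Z}$-submodule $\mathfrak{a}_{\mathbb{Z}}$ closed under the Lie bracket with $\mathfrak{a}\simeq\mathbb{C}\otimes_{\mathbb{Z}}\mathfrak{a}_{\mathbb{Z}}$.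 The integers $\kappa_{\alpha,\beta}$ are defined by $[e_\alpha,e_\beta]=\kappa_{\alpha,\beta}e_{\alpha+\beta}$ if $\alpha,\beta,\alpha+\beta\in\Phi$; $\kappa_{\alpha,\beta}:=0$ if $\alpha+\beta\notin\Phi$. Note $y_{-\alpha}=-y_\alpha$. *)

(* Defs.v *)
From HB Require Import structures.
From mathcomp Require Import all_boot all_order all_algebra.
From mathcomp Require Export reals complex.

Set Implicit Arguments.
Unset Strict Implicit.
Unset Printing Implicit Defensive.

Import Order.TTheory GRing.Theory Num.Theory.
Local Open Scope ring_scope.

Reserved Notation "[ 'lie' x , y ]" (at level 0, x, y at level 200,
  format "[ 'lie'  x ,  y ]").

HB.mixin Record isLie (K : fieldType) L of Vector K L := {
  lie_bracket : L -> L -> L;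
  lie_linearl : forall y, linear (fun x => lie_bracket x y);
  lie_linearr : forall x, linear (lie_bracket x);
  lie_alternating : forall x, lie_bracket x x = 0;
  lie_jacobi : forall x y z,
    lie_bracket x (lie_bracket y z) + lie_bracket y (lie_bracket z x)
      + lie_bracket z (lie_bracket x y) = 0
}.

#[short(type="lieAlgType")]
HB.structure Definition LieAlgebra (K : fieldType) :=
  {L of isLie K L & Vector K L}.

Notation "[ 'lie' x , y ]" := (lie_bracket x y) : ring_scope.

Definition lie_subalgebra (K : fieldType) (g : lieAlgType K) (U : {vspace g}) :=
  forall x y, x \in U -> y \in U -> [lie x, y] \in U.

Definition lie_ideal (K : fieldType) (g : lieAlgType K) (U : {vspace g}) :=
  forall x y, y \in U -> [lie x, y] \in U.

Definition lie_simple (K : fieldType) (g : lieAlgType K) :=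
  (exists x y : g, [lie x, y] != 0) /\
  (forall U : {vspace g}, lie_ideal U -> U = 0%VS \/ U = fullv).

Definition lie_prodv (K : fieldType) (g : lieAlgType K) (U V : {vspace g}) :
    {vspace g} :=
  <<[seq [lie u, v] | u <- vbasis U, v <- vbasis V]>>%VS.

Definition lower_central (K : fieldType) (g : lieAlgType K) (U : {vspace g})
    (n : nat) : {vspace g} :=
  iter n (lie_prodv U) U.

Definition lie_nilpotent (K : fieldType) (g : lieAlgType K) (U : {vspace g}) :=
  exists n, lower_central U n = 0%VS.

Definition cartan_subalgebra (K : fieldType) (g : lieAlgType K)
    (H : {vspace g}) :=
  [/\ lie_subalgebra H, lie_nilpotent H &
      forall x, (forall y, y \in H -> [lie x, y] \in H) -> x \in H].

Definition dual (K : fieldType) (g : lieAlgType K) (H : {vspace g}) :=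
  'Hom(subvs_of H, K^o).

Definition root_space (K : fieldType) (g : lieAlgType K) (H : {vspace g})
    (a : dual H) (x : g) :=
  forall h : subvs_of H, [lie vsval h, x] = (a h : K) *: x.

Definition is_root (K : fieldType) (g : lieAlgType K) (H : {vspace g})
    (a : dual H) :=
  a != 0 /\ exists x : g, x != 0 /\ root_space a x.

Definition nat_comb (V : zmodType) (r : nat) (D : r.-tuple V) (a : V) :=
  exists n : 'I_r -> nat, a = \sum_(i < r) tnth D i *+ n i.

Definition simple_roots (K : fieldType) (g : lieAlgType K) (H : {vspace g})
    (r : nat) (D : r.-tuple (dual H)) :=
  [/\ forall i, is_root (tnth D i),
      basis_of fullv D &
      forall a : dual H, is_root a -> nat_comb D a \/ nat_comb D (- a)].

Definition pos_root (K : fieldType) (g : lieAlgType K) (H : {vspace g})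
    (r : nat) (D : r.-tuple (dual H)) (a : dual H) :=
  is_root a /\ nat_comb D a.

Definition invariant_form (K : fieldType) (g : lieAlgType K)
    (B : g -> g -> K) :=
  forall x y z : g, B [lie x, y] z = B x [lie y, z].

(* [t] is the identification a |-> t_a of the dual of H with H given by B *)
Definition form_dual (K : fieldType) (g : lieAlgType K) (H : {vspace g})
    (B : g -> g -> K) (t : dual H -> g) :=
  forall a : dual H,
    t a \in H /\ forall h : subvs_of H, B (t a) (vsval h) = a h.

Definition dual_form (K : fieldType) (g : lieAlgType K) (H : {vspace g})
    (B : g -> g -> K) (t : dual H -> g) (a b : dual H) : K :=
  B (t a) (t b).

(* Before normalization the form is only known up to a nonzero complex factor,
   so root lengths are compared through moduli; the values (a, a) on roots are
   positive multiples of each other, hence this does not depend on the factor. *)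
Definition long_root (K : numFieldType) (g : lieAlgType K) (H : {vspace g})
    (B : g -> g -> K) (t : dual H -> g) (a : dual H) :=
  is_root a /\
  forall b : dual H, is_root b -> `|dual_form B t b b| <= `|dual_form B t a a|.

Definition normalized_form (K : numFieldType) (g : lieAlgType K)
    (H : {vspace g}) (B : g -> g -> K) (t : dual H -> g) :=
  forall a : dual H, long_root B t a -> dual_form B t a a = 2.

Definition coroot (K : fieldType) (g : lieAlgType K) (H : {vspace g})
    (B : g -> g -> K) (t : dual H -> g) (a : dual H) : g :=
  (2 / dual_form B t a a) *: t a.

(* The family is v restricted to the indices satisfying P; for A = int, V is
   used below at [zmodule g], the additive group of g as a Z-module. *)

Definition in_span (A : nzRingType) (V : lmodType A) (I : eqType)
    (P : I -> Prop) (v : I -> V) (x : V) :=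
  exists (s : seq I) (c : I -> A),
    (forall i, i \in s -> P i) /\ x = \sum_(i <- s) c i *: v i.

Definition lin_indep (A : nzRingType) (V : lmodType A) (I : eqType)
    (P : I -> Prop) (v : I -> V) :=
  forall (s : seq I) (c : I -> A), uniq s -> (forall i, i \in s -> P i) ->
    \sum_(i <- s) c i *: v i = 0 -> forall i, i \in s -> c i = 0.

Definition is_basis (A : nzRingType) (V : lmodType A) (I : eqType)
    (P : I -> Prop) (v : I -> V) (M : V -> Prop) :=
  (forall x, M x <-> in_span P v x) /\ lin_indep P v.

Definition chevalley_generators (K : fieldType) (g : lieAlgType K)
    (H : {vspace g}) (B : g -> g -> K) (t : dual H -> g)
    (r : nat) (D : r.-tuple (dual H)) (ei fi : 'I_r -> g) :=
  forall i, [/\ root_space (tnth D i) (ei i),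
                root_space (- tnth D i) (fi i) &
                [lie ei i, fi i] = coroot B t (tnth D i)].

Definition chevalley_involution (K : fieldType) (g : lieAlgType K)
    (H : {vspace g}) (r : nat) (ei fi : 'I_r -> g) (omega : 'End(g)) :=
  [/\ forall x y : g, omega [lie x, y] = [lie omega x, omega y],
      forall x : g, omega (omega x) = x,
      forall h, h \in H -> omega h = - h &
      forall i, omega (ei i) = - fi i].

(* The family (h_i, e_a), with i < r and a a root; [e] is irrelevant outside
   the roots. *)
Definition chevalley_index (K : fieldType) (g : lieAlgType K)
    (H : {vspace g}) (r : nat) (k : 'I_r + dual H) : Prop :=
  match k with inl _ => True | inr a => is_root a end.

Definition chevalley_family (K : fieldType) (g : lieAlgType K)
    (H : {vspace g}) (B : g -> g -> K) (t : dual H -> g)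
    (r : nat) (D : r.-tuple (dual H)) (e : dual H -> g)
    (k : 'I_r + dual H) : g :=
  match k with inl i => coroot B t (tnth D i) | inr a => e a end.

Definition chevalley_basis (K : fieldType) (g : lieAlgType K)
    (H : {vspace g}) (B : g -> g -> K) (t : dual H -> g)
    (r : nat) (D : r.-tuple (dual H)) (ei fi : 'I_r -> g)
    (e : dual H -> g) :=
  [/\ forall i, e (tnth D i) = ei i /\ e (- tnth D i) = fi i,
      forall a, is_root a -> root_space a (e a),
      forall a, is_root a -> [lie e a, e (- a)] = coroot B t a &
      is_basis (@chevalley_index K g H r) (chevalley_family B t D e)
        (fun _ => True)].

Definition structure_constants (K : fieldType) (g : lieAlgType K)
    (H : {vspace g}) (e : dual H -> g) (kappa : dual H -> dual H -> int) :=
  (forall a b : dual H, is_root a -> is_root b -> is_root (a + b) ->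
     [lie e a, e b] = e (a + b) *~ kappa a b) /\
  (forall a b : dual H, ~ is_root (a + b) -> kappa a b = 0).

Definition chevalley_Zspan (K : fieldType) (g : lieAlgType K)
    (H : {vspace g}) (B : g -> g -> K) (t : dual H -> g)
    (r : nat) (D : r.-tuple (dual H)) (e : dual H -> g) : g -> Prop :=
  @in_span int (zmodule g) _ (@chevalley_index K g H r)
    (chevalley_family B t D e).

Definition y_elt (K : fieldType) (g : lieAlgType K) (H : {vspace g})
    (e : dual H -> g) (a : dual H) : g :=
  e a - e (- a).

(* For a subgroup M of U, (c, m) |-> c *: m exhibits U as the tensor product
   of K and M over Z: any map phi on K * M, additive in each argument, factors
   through a unique additive map on U. *)
Definition is_scalar_extension (K : fieldType) (V : vectType K)
    (U : {vspace V}) (M : V -> Prop) :=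
  forall (W : zmodType) (phi : K -> V -> W),
    (forall c d m, M m -> phi (c + d) m = phi c m + phi d m) ->
    (forall c m n, M m -> M n -> phi c (m + n) = phi c m + phi c n) ->
    exists F : {additive subvs_of U -> W},
      (forall c m, M m -> F (vsproj U (c *: m)) = phi c m) /\
      (forall G : {additive subvs_of U -> W},
         (forall c m, M m -> G (vsproj U (c *: m)) = phi c m) -> G =1 F).

(* The isomorphism with the extension of scalars is the natural one, so it is
   K-linear and, the bracket being bilinear, compatible with brackets. *)
Definition integral_form (K : fieldType) (g : lieAlgType K)
    (U : {vspace g}) (M : g -> Prop) :=
  [/\ lie_subalgebra U,
      forall x, M x -> x \in U,
      M 0 /\ (forall x y, M x -> M y -> M (x - y)),
      forall x y, M x -> M y -> M [lie x, y] &
      is_scalar_extension U M].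

(* Main.v *)
Require Import Defs.
From HB Require Import structures.
From mathcomp Require Import all_boot all_order all_algebra.
From mathcomp Require Import boolp.

Set Implicit Arguments.
Unset Strict Implicit.
Unset Printing Implicit Defensive.

Import Order.TTheory GRing.Theory Num.Theory.
Local Open Scope ring_scope.

(** Since [omega] sends [h_i] to [- h_i] and [e_a] to [- e_(- a)], an element
    with coordinates [c] in the Chevalley basis is fixed exactly when
    [2 c(h_i) = 0] and [c(a) + c(- a) = 0]. Over any coefficient domain of
    characteristic 0, so over both the complex numbers and Z, the [y_a] with
    [a] positive therefore form a basis of the fixed points; a common basis makes
    the fixed subalgebra the scalar extension of its integral points. Applying
    [omega] to [[e_a, e_b] = kappa_(a, b) e_(a + b)] gives
    [kappa_(- a, - b) = - kappa_(a, b)], hence the formula for [[y_a, y_b]],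
    and this formula shows that the integral points are closed under brackets. *)

(** * Spans and independent families over a ring *)

Lemma in_spanP (A : nzRingType) (V : lmodType A) (I : eqType)
    (P : I -> Prop) (v : I -> V) (s : seq I) :
  uniq s -> (forall i, i \in s <-> P i) ->
  forall x, in_span P v x <-> exists c, x = \sum_(i <- s) c i *: v i.
Proof.
move=> s_uniq sP x; split=> [[s' [c [s'P ->]]]|[c ->]]; last first.
  by exists s, c; split=> // i /sP.
(* The list [s'] may repeat indices and miss others; the coefficients of equal indices are added
   up. *)
exists (fun i => \sum_(j <- s' | j == i) c j).
under [RHS]eq_bigr do rewrite scaler_suml big_mkcond /=.
rewrite [RHS]exchange_big /= !big_seq; apply: eq_bigr => j /s'P /sP js.
rewrite (bigD1_seq j) //= eqxx big1 ?addr0 // => i /negPf ij.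
by rewrite eq_sym ij.
Qed.

Lemma in_span0 (A : nzRingType) (V : lmodType A) (I : eqType)
    (P : I -> Prop) (v : I -> V) : in_span P v 0.
Proof. by exists [::], (fun=> 0); rewrite big_nil. Qed.

Lemma in_span_id (A : nzRingType) (V : lmodType A) (I : eqType)
    (P : I -> Prop) (v : I -> V) (i : I) : P i -> in_span P v (v i).
Proof.
move=> Pi; exists [:: i], (fun=> 1); rewrite big_seq1 scale1r.
by split=> // j; rewrite inE => /eqP ->.
Qed.

Lemma in_spanB (A : nzRingType) (V : lmodType A) (I : eqType)
    (P : I -> Prop) (v : I -> V) (s : seq I) :
  uniq s -> (forall i, i \in s <-> P i) ->
  forall x y, in_span P v x -> in_span P v y -> in_span P v (x - y).
Proof.
move=> s_uniq sP x y; rewrite !(in_spanP _ s_uniq sP) => -[c ->] [d ->].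
exists (fun i => c i - d i); rewrite -sumrB.
by apply: eq_bigr => i _; rewrite scalerBl.
Qed.

Lemma lin_indep_free (K : fieldType) (V : vectType K) (I : eqType)
    (P : I -> Prop) (v : I -> V) (s : seq I) :
  lin_indep P v -> uniq s -> (forall i, i \in s -> P i) -> free (map v s).
Proof.
move=> v_indep s_uniq sP.
apply/(@freeP _ _ _ (in_tuple (map v s))) => k k0 i.
have i_lt : (i < size s)%N by rewrite -(size_map v s).
(* [I] could be empty; the position [i] shows that [s] is not, which supplies a default for
   [nth]. *)
have i0 : I by move: (nat_of_ord i) i_lt; case: (s) => [[]|i0].
pose c j := if insub (index j s) is Some m then k m else 0.
have cE (m : 'I_(size (map v s))) : c (nth i0 s m) = k m.
  rewrite /c index_uniq ?valK //.
  by rewrite -(size_map v s).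
rewrite -cE; apply: (v_indep s c s_uniq sP); last first.
  by rewrite mem_nth.
rewrite -[RHS]k0 (big_nth i0) -(size_map v s) big_mkord; apply: eq_bigr => m _.
rewrite cE (nth_map i0) //.
by rewrite -(size_map v s).
Qed.

(** Roots are given only by a predicate, and their finiteness comes from here. If no list exhausted
    [P], every duplicate-free list in [P] could be lengthened, eventually past the dimension of
    [V]. *)
Lemma lin_indep_enum (K : fieldType) (V : vectType K) (I : eqType)
    (P : I -> Prop) (v : I -> V) :
  lin_indep P v -> exists s : seq I, uniq s /\ forall i, i \in s <-> P i.
Proof.
move=> v_indep; apply: contrapT => no_enum.
have [s [s_uniq sP s_size]] : exists s : seq I,
    [/\ uniq s, forall i, i \in s -> P i & size s = (\dim {:V}).+1].
  elim: (\dim {:V}).+1 => [|n [s [s_uniq sP s_size]]]; first by exists [::].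
  have [i [Pi i_s]] : exists i, P i /\ i \notin s.
    apply: contrapT => s_full; apply: no_enum; exists s; split=> // i.
    split=> [/sP//|Pi]; apply/negPn/negP => i_s.
    by apply: s_full; exists i.
  exists (i :: s); split; rewrite /= ?i_s ?s_size //.
  by move=> j; rewrite inE => /predU1P[->|/sP].
have /eqP dim_s := lin_indep_free v_indep s_uniq sP.
have := dimvS (subvf <<map v s>>).
by rewrite dim_s size_map s_size ltnn.
Qed.

(** * Integral spans and extension of scalars *)

(** Integer multiples are iterated sums or their negatives, so closure under subtraction is
    enough. *)
Lemma in_span_int_ind (U : zmodType) (I : eqType) (P : I -> Prop)
    (v : I -> zmodule U) (Q : U -> Prop) :
  Q 0 -> (forall x y, Q x -> Q y -> Q (x - y)) -> (forall i, P i -> Q (v i)) ->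
  forall x, in_span P v x -> Q x.
Proof.
move=> Q0 QB Qv x [s [c [sP ->]]].
have QN y : Q y -> Q (- y) by move=> Qy; rewrite -sub0r; apply: QB.
have QD y z : Q y -> Q z -> Q (y + z).
  by move=> Qy Qz; rewrite -[z]opprK; apply/QB/QN.
rewrite big_seq; apply: (big_ind Q) => // i /sP/Qv Qi.
rewrite scalezrE; case: (c i) => n; rewrite ?NegzE ?mulrNz -!pmulrn.
  by elim: n => [|n IHn]; rewrite ?mulr0n // mulrS; apply: QD.
by apply: QN; elim: n => [|n IHn]; rewrite ?mulr1n // mulrS; apply: QD.
Qed.

(** The factorization is forced to be the sum of [phi (coord x i) (v i)] over the basis, because the
    multiples [c *: v i] generate [U] additively. *)
Lemma scalar_extension_basis (K : fieldType) (V : vectType K) (U : {vspace V})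
    (M : V -> Prop) (I : eqType) (P : I -> Prop) (v : I -> V) :
  @is_basis int (zmodule V) _ P v M ->
  is_basis P v (fun x => x \in U) ->
  is_scalar_extension U M.
Proof.
move=> [MP _] [UP v_indep] W phi phiDl phiDr.
have [s [s_uniq sP]] := lin_indep_enum v_indep.
have M0 : M 0 by apply/MP/in_span0.
have MB x y : M x -> M y -> M (x - y).
  by rewrite !MP; apply: (@in_spanB int (zmodule V) _ _ _ s).
have Mv i : i \in s -> M (v i).
  by move=> /sP Pi; apply/MP; apply: (@in_span_id int (zmodule V)).
have UE x : x \in U <-> exists c, x = \sum_(i <- s) c i *: v i.
  by rewrite UP (in_spanP _ s_uniq sP).
have phi0l m : M m -> phi 0 m = 0.
  by move=> Mm; apply: (addrI (phi 0 m)); rewrite -phiDl // !addr0.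
have phi0r c : phi c 0 = 0.
  by apply: (addrI (phi c 0)); rewrite -phiDr // !addr0.
have phiNl c m : M m -> phi (- c) m = - phi c m.
  move=> Mm; apply: (addrI (phi c m)).
  by rewrite -phiDl // !subrr phi0l.
have MN m : M m -> M (- m) by move=> Mm; rewrite -sub0r; apply: MB.
have phiNr c m : M m -> phi c (- m) = - phi c m.
  move=> Mm; apply: (addrI (phi c m)).
  by rewrite -phiDr ?subrr ?phi0r //; apply: MN.
have /choice[coord coordE] (x : subvs_of U) :
    exists c, vsval x = \sum_(i <- s) c i *: v i by apply/UE/subvsP.
(* The choice of [coord] is arbitrary outside [s]; on [s] independence determines it, which is what
   makes [F0] additive. *)
have coord_uniq x c : vsval x = \sum_(i <- s) c i *: v i ->
    forall i, i \in s -> coord x i = c i.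
  move=> xE i i_s; apply/eqP; rewrite -subr_eq0; apply/eqP.
  apply: (v_indep s (fun i => coord x i - c i)) => //; first by move=> j /sP.
  under eq_bigr do rewrite scalerBl.
  by rewrite sumrB -coordE -xE subrr.
pose F0 x := \sum_(i <- s) phi (coord x i) (v i).
have F0B : zmod_morphism F0.
  move=> x y; rewrite /F0 -sumrB !big_seq; apply: eq_bigr => i i_s.
  rewrite (coord_uniq _ (fun i => coord x i - coord y i)) //.
    by rewrite phiDl ?phiNl //; apply: Mv.
  rewrite raddfB /= !coordE -sumrB.
  by apply: eq_bigr => j _; rewrite scalerBl.
pose F : {additive subvs_of U -> W} :=
  HB.pack F0 (GRing.isZmodMorphism.Build _ _ F0 F0B).
have FE c m : M m -> F (vsproj U (c *: m)) = phi c m.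
  move=> Mm.
  (* Additivity of [phi] in its second argument is known only on [M], so membership in [M] is
     carried through the induction. *)
  suff [] : M m /\ F (vsproj U (c *: m)) = phi c m by [].
  move/MP: Mm; move: m.
  apply: (in_span_int_ind (U := V) (Q := fun m => M m /\ _)).
  - by rewrite scaler0 !raddf0 phi0r.
  - move=> x y [Mx Fx] [My Fy]; split; first exact: MB.
    by rewrite scalerBr !raddfB phiDr ?phiNr ?Fx ?Fy //; apply: MN.
  - move=> i Pi; have i_s : i \in s by apply/sP.
    split; first exact: Mv.
    have viU : v i \in U by apply/UP/in_span_id.
    have projE : vsval (vsproj U (c *: v i)) =
        \sum_(j <- s) (if j == i then c else 0) *: v j.
      rewrite vsprojK ?memvZ // (bigD1_seq i) //= eqxx big1 ?addr0 //.
      by move=> j /negPf ->; rewrite scale0r.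
    rewrite /F /= /F0 (bigD1_seq i) //= (coord_uniq _ _ projE) // eqxx.
    rewrite big_seq_cond big1 ?addr0 // => j /andP[j_s /negPf ji].
    by rewrite (coord_uniq _ _ projE) // ji phi0l //; apply: Mv.
exists F; split=> // G GE x.
have -> : x = \sum_(i <- s) vsproj U (coord x i *: v i).
  by rewrite -raddf_sum -coordE /= vsvalK.
rewrite !raddf_sum big_seq [RHS]big_seq; apply: eq_bigr => i i_s.
by rewrite GE ?FE //; apply: Mv.
Qed.

(** * Fixed points of a map acting like the Chevalley involution *)

(** The coefficient ring is left general so that one argument serves both the complex numbers and
    the integers. [J] indexes the Cartan part, and [W] contains the roots. *)
Lemma fixed_points_basis (A : numDomainType) (V : lmodType A) (J : finType)
    (W : zmodType) (pos : W -> Prop) (Q : J + W -> Prop) (v : J + W -> V)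
    (omega : {linear V -> V}) (s : seq W) :
  (forall j, Q (inl j)) -> (forall a, Q (inr a) <-> pos a \/ pos (- a)) ->
  (forall a, pos a -> pos (- a) -> False) ->
  uniq s -> (forall a, a \in s <-> pos a) ->
  (forall j, omega (v (inl j)) = - v (inl j)) ->
  (forall a, Q (inr a) -> omega (v (inr a)) = - v (inr (- a))) ->
  lin_indep Q v ->
  is_basis pos (fun a => v (inr a) - v (inr (- a)))
    (fun x => in_span Q v x /\ omega x = x).
Proof.
move=> Qinl Qinr posN s_uniq sP omega_inl omega_inr v_indep.
have inrI : injective (@inr J W) by move=> a b [].
have inrNI : injective (fun a => @inr J W (- a)) by move=> a b [] /oppr_inj.
have sN a : a \in s -> - a \in s = false.
  by move=> /sP pos_a; apply/negP => /sP; apply: posN.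
(* For [l = s] this enumerates all of [Q]. Arbitrary [l] is allowed because independence has to be
   tested on every list of positive indices. *)
pose S (l : seq W) : seq (J + W) :=
  map inl (index_enum J) ++ map inr l ++ map (fun a => inr (- a)) l.
have SQ l : (forall a, a \in l -> pos a) -> forall k, k \in S l -> Q k.
  move=> lP k; rewrite !mem_cat => /or3P[] /mapP[a]; first by move=> _ ->.
    by move=> /lP pos_a ->; apply/Qinr; left.
  by move=> /lP pos_a ->; apply/Qinr; right; rewrite opprK.
have S_uniq l : uniq l -> (forall a, a \in l -> pos a) -> uniq (S l).
  move=> l_uniq lP; rewrite !cat_uniq !map_inj_uniq //=; last first.
    by move=> i j [].
  rewrite l_uniq andbT index_enum_uniq /=; apply/andP; split; apply/hasPn => k.
    rewrite mem_cat => /orP[] /mapP[a _ ->];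
    by apply/negP => /mapP[].
  move=> /mapP[a /lP pos_a ->]; apply/negP => /mapP[b /lP pos_b [ab]].
  by apply: (posN _ pos_a); rewrite ab.
have SE l c : \sum_(k <- S l) c k *: v k =
    \sum_j c (inl j) *: v (inl j) + \sum_(a <- l)
      (c (inr a) *: v (inr a) + c (inr (- a)) *: v (inr (- a))).
  by rewrite !big_cat /= !big_map big_split.
have Qs a : a \in s -> Q (inr a) /\ Q (inr (- a)).
  by move=> /sP pos_a; rewrite !Qinr opprK; split; [left|right].
have SP k : k \in S s <-> Q k.
  split; first by apply: SQ => a /sP.
  rewrite !mem_cat; case: k => [j _|a /Qinr[] /sP a_s].
  - by rewrite map_f ?mem_index_enum.
  - by rewrite [_ \in map inr s]map_f ?orbT.
  - by rewrite -[a]opprK (map_f (fun a => inr (- a))) ?orbT.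
split; last first.
  move=> l c l_uniq lP /= cy0 a a_l.
  (* Coordinates in [v] of the given combination of differences: [c b] at [b] and [- c b] at [- b].
     The test on [l] separates the two cases since [b] and [- b] are never both positive. *)
  pose d (k : J + W) :=
    if k is inr b then if b \in l then c b else - c (- b) else 0.
  have <- : d (inr a) = c a by rewrite /d a_l.
  apply: (v_indep (S l) d (S_uniq l l_uniq lP) (SQ l lP)); last first.
    by rewrite !mem_cat map_f ?orbT.
  rewrite SE big1 ?add0r; last by move=> j _; rewrite scale0r.
  rewrite -[RHS]cy0 !big_seq; apply: eq_bigr => b b_l.
  rewrite /d b_l opprK ifN ?scaleNr ?scalerBr //.
  by apply/negP => /lP; apply: posN; apply: lP.
move=> x; rewrite (in_spanP _ s_uniq sP) (in_spanP _ (S_uniq s s_uniq _) SP);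
  last by move=> a /sP.
split=> [[[c ->] omega_x]|[c ->]]; last first.
  split.
    pose d (k : J + W) :=
      if k is inr b then if b \in s then c b else - c (- b) else 0.
    exists d; rewrite SE [X in X + _]big1 ?add0r; last by move=> j _; rewrite scale0r.
    rewrite !big_seq; apply: eq_bigr => b b_s.
    by rewrite /d b_s opprK sN // scaleNr scalerBr.
  rewrite raddf_sum /= !big_seq; apply: eq_bigr => a /Qs[Qa QNa].
  by rewrite linearZ /= raddfB /= !omega_inr // !opprK addrC.
(* These are the coordinates of [x - omega x], which vanishes. *)
pose d (k : J + W) :=
  if k is inr a then c (inr a) + c (inr (- a)) else c k *+ 2.
have d0 : \sum_(k <- S s) d k *: v k = 0.
  set z := \sum_(k <- S s) c k *: v k in omega_x.
  transitivity (z - omega z); last by rewrite omega_x subrr.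
  rewrite /z !SE raddfD opprD /= addrACA.
  congr (_ + _).
    rewrite raddf_sum /= -sumrB; apply: eq_bigr => j _.
    by rewrite linearZ /= omega_inl scalerN opprK /d mulr2n scalerDl.
  rewrite raddf_sum /= -sumrB !big_seq; apply: eq_bigr => a /Qs[Qa QNa].
  rewrite raddfD /= !linearZ /= !omega_inr // opprK !scalerN opprD !opprK.
  rewrite /d [c (inr (- a)) + _]addrC !scalerDl.
  by rewrite [X in _ = _ + X]addrC [RHS]addrACA [X in _ = _ + X]addrC.
have {}d0 k : Q k -> d k = 0.
  move=> Qk; apply: (v_indep (S s)) => //.
  - by apply: S_uniq => // a /sP.
  - by move=> i /SP.
  - exact/SP.
exists (fun a => c (inr a)).
rewrite SE [X in X + _]big1 ?add0r => [|j _]; last first.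
  by have /eqP := d0 _ (Qinl j); rewrite mulrn_eq0 => /eqP ->; rewrite scale0r.
rewrite !big_seq; apply: eq_bigr => a /sP pos_a.
have /eqP : d (inr a) = 0 by apply/d0/Qinr; left.
by rewrite /d addrC addr_eq0 => /eqP ->; rewrite scalerBr scaleNr.
Qed.

(** An integral relation is a relation over [K], and the integers embed in [K] in characteristic
    0. *)
Lemma lin_indep_int (K : numFieldType) (V : lmodType K) (I : eqType)
    (P : I -> Prop) (v : I -> V) :
  lin_indep P v -> @lin_indep int (zmodule V) _ P v.
Proof.
move=> v_indep s c s_uniq sP c0 i i_s; apply/eqP; rewrite -(intr_eq0 K).
apply/eqP; apply: (v_indep s (fun j => (c j)%:~R)) => //.
by rewrite -[RHS]c0; apply: eq_bigr => j _; rewrite scaler_int scalezrE.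
Qed.

(** Freeness kills each [n i + m i], and natural numbers with sum 0 are both 0. This keeps sums of
    positive roots away from 0 and positive roots apart from negative ones. *)
Lemma nat_comb_addr_eq0 (K : numFieldType) (V : vectType K) (r : nat)
    (D : r.-tuple V) (a b : V) :
  free D -> nat_comb D a -> nat_comb D b -> a + b = 0 -> a = 0.
Proof.
move=> /freeP D_free [n ->] [m ->] ab0; apply: big1 => i _.
suff /eqP : (n i + m i)%:R = 0 :> K.
  by rewrite pnatr_eq0 addn_eq0 => /andP[/eqP -> _].
apply: (D_free (fun j => (n j + m j)%:R)).
rewrite -[RHS]ab0 -big_split; apply: eq_bigr => j _.
by rewrite -tnth_nth scaler_nat mulrnDr.
Qed.

(** * Brackets, root spaces and the action of the involution *)

Lemma lieDl (K : fieldType) (g : lieAlgType K) (x y z : g) :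
  [lie x + y, z] = [lie x, z] + [lie y, z].
Proof. by have := lie_linearl z 1 x y; rewrite !scale1r. Qed.

Lemma lieDr (K : fieldType) (g : lieAlgType K) (x y z : g) :
  [lie x, y + z] = [lie x, y] + [lie x, z].
Proof. by have := lie_linearr x 1 y z; rewrite !scale1r. Qed.

Lemma lie0l (K : fieldType) (g : lieAlgType K) (x : g) : [lie 0, x] = 0.
Proof. by apply: (addrI [lie 0, x]); rewrite -lieDl !addr0. Qed.

Lemma lie0r (K : fieldType) (g : lieAlgType K) (x : g) : [lie x, 0] = 0.
Proof. by apply: (addrI [lie x, 0]); rewrite -lieDr !addr0. Qed.

Lemma lieZl (K : fieldType) (g : lieAlgType K) (c : K) (x y : g) :
  [lie c *: x, y] = c *: [lie x, y].
Proof. by have := lie_linearl y c x 0; rewrite !(addr0, lie0l). Qed.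

Lemma lieZr (K : fieldType) (g : lieAlgType K) (c : K) (x y : g) :
  [lie x, c *: y] = c *: [lie x, y].
Proof. by have := lie_linearr x c y 0; rewrite !(addr0, lie0r). Qed.

Lemma lieNl (K : fieldType) (g : lieAlgType K) (x y : g) :
  [lie - x, y] = - [lie x, y].
Proof. by rewrite -scaleN1r lieZl scaleN1r. Qed.

Lemma lieNr (K : fieldType) (g : lieAlgType K) (x y : g) :
  [lie x, - y] = - [lie x, y].
Proof. by rewrite -scaleN1r lieZr scaleN1r. Qed.

Lemma lieC (K : fieldType) (g : lieAlgType K) (x y : g) :
  [lie x, y] = - [lie y, x].
Proof.
apply/eqP; rewrite -addr_eq0; have := lie_alternating (x + y).
by rewrite lieDl !lieDr !lie_alternating add0r addr0 => ->.
Qed.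

(** By the Jacobi identity, bracketing with [h] is a derivation, so eigenvalues add. *)
Lemma root_space_lie (K : fieldType) (g : lieAlgType K) (H : {vspace g})
    (a b : dual H) (x y : g) :
  root_space a x -> root_space b y -> root_space (a + b) [lie x, y].
Proof.
move=> xa yb h; have := lie_jacobi (vsval h) x y.
rewrite (lieC y (vsval h)) xa yb lieNr !lieZr (lieC y x) scalerN.
by move/eqP; rewrite addrAC -addrA -opprD subr_eq0 => /eqP ->;
  rewrite add_lfunE scalerDl addrC.
Qed.

Lemma lie_fixedSpace (K : fieldType) (g : lieAlgType K) (omega : 'End(g)) :
  (forall x y : g, omega [lie x, y] = [lie omega x, omega y]) ->
  lie_subalgebra (fixedSpace omega).
Proof.
by move=> omegaM x y /fixedSpaceP x_fix /fixedSpaceP y_fix;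
  apply/fixedSpaceP; rewrite omegaM x_fix y_fix.
Qed.

(** Applying [omega] to the eigenvector equation replaces [h] by [- h]. *)
Lemma root_space_opp (K : fieldType) (g : lieAlgType K) (H : {vspace g})
    (omega : 'End(g)) (a : dual H) (x : g) :
  (forall x y : g, omega [lie x, y] = [lie omega x, omega y]) ->
  (forall h, h \in H -> omega h = - h) ->
  root_space a x -> root_space (- a) (omega x).
Proof.
move=> omegaM omegaH xa h.
rewrite opp_lfunE scaleNr -linearZ /= -xa omegaM (omegaH (vsval h)) ?subvsP //.
by rewrite lieNl opprK.
Qed.

Lemma root_opp (K : fieldType) (g : lieAlgType K) (H : {vspace g})
    (omega : 'End(g)) (a : dual H) :
  (forall x y : g, omega [lie x, y] = [lie omega x, omega y]) ->
  (forall x : g, omega (omega x) = x) ->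
  (forall h, h \in H -> omega h = - h) ->
  is_root a -> is_root (- a).
Proof.
move=> omegaM omegaK omegaH [a0 [x [x0 xa]]]; split; first by rewrite oppr_eq0.
exists (omega x); split; last exact: root_space_opp.
by apply: contraNneq x0 => ox0; rewrite -(omegaK x) ox0 raddf0.
Qed.

(** Of the four terms of the expanded bracket, [omega] exchanges [[lie e a, e b]] with
    [[lie e (- a), e (- b)]], and likewise the two mixed terms; each pair contributes one
    summand. *)
Lemma lie_y_elt (K : fieldType) (g : lieAlgType K) (H : {vspace g})
    (omega : 'End(g)) (e : dual H -> g) (kappa : dual H -> dual H -> int)
    (a b : dual H) :
  (forall x y : g, omega [lie x, y] = [lie omega x, omega y]) ->
  (forall a : dual H, is_root a -> is_root (- a)) ->
  (forall a : dual H, is_root a -> root_space a (e a)) ->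
  (forall a : dual H, is_root a -> omega (e a) = - e (- a)) ->
  structure_constants e kappa ->
  is_root a -> is_root b -> a + b != 0 -> a - b != 0 ->
  [lie y_elt e a, y_elt e b] =
    y_elt e (a + b) *~ kappa a b - y_elt e (a - b) *~ kappa a (- b).
Proof.
move=> omegaM rootN e_root omega_e [kappaE kappa0] ra rb ab0 ab'0.
have lie_e c d : is_root c -> is_root d -> c + d != 0 ->
    [lie e c, e d] + [lie e (- c), e (- d)] = y_elt e (c + d) *~ kappa c d.
  move=> rc rd cd0.
  have -> : [lie e (- c), e (- d)] = omega [lie e c, e d].
    by rewrite omegaM !omega_e // lieNl lieNr opprK.
  have [rcd|ncd] := pselect (is_root (c + d)).
    by rewrite kappaE // raddfMz /= omega_e // -mulrzDl.
  (* The bracket has weight [c + d], which is nonzero; were the bracket nonzero, [c + d] would be a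
     root. *)
  rewrite kappa0 // mulr0z; have [->|cd] := eqVneq [lie e c, e d] 0.
    by rewrite raddf0 addr0.
  case: ncd; split=> //; exists [lie e c, e d]; split=> //.
  by apply: root_space_lie; apply: e_root.
rewrite -!lie_e //; last exact: rootN.
rewrite /y_elt lieDl !lieDr !lieNl !lieNr !opprK.
rewrite opprD [RHS]addrACA.
congr (_ + _); exact: addrC.
Qed.

(** * Integral form, basis and structure constants of the fixed subalgebra *)

Theorem lemma3p2 (R : realType) (g : lieAlgType R[i])
  (g_simple : lie_simple g)
  (H : {vspace g}) (H_cartan : cartan_subalgebra H)
  (r : nat) (alpha : r.-tuple (dual H)) (alpha_simple : simple_roots alpha)
  (B : {symmetric g}) (B_nondeg : nondegenerate B)
  (B_inv : invariant_form B)
  (t : dual H -> g) (t_dual : form_dual B t)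
  (B_normalized : normalized_form B t)
  (ei fi : 'I_r -> g) (gens : chevalley_generators B t alpha ei fi)
  (omega : 'End(g)) (omega_chevalley : chevalley_involution H ei fi omega)
  (e : dual H -> g) (e_basis : chevalley_basis B t alpha ei fi e)
  (omega_e : forall a : dual H, is_root a -> omega (e a) = - e (- a))
  (kappa : dual H -> dual H -> int)
  (kappa_e : structure_constants e kappa) :
  let k := fixedSpace omega in
  let kZ := fun x : g => chevalley_Zspan B t alpha e x /\ omega x = x in
  let y := y_elt e in
  [/\ integral_form k kZ,
      @is_basis int (zmodule g) _ (pos_root alpha) y kZ &
      forall a b : dual H, pos_root alpha a -> pos_root alpha b -> a != b ->
        [lie y a, y b] = y (a + b) *~ kappa a b - y (a - b) *~ kappa a (- b)].
Proof.
move=> k kZ y.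
have [omegaM omegaK omegaH _] := omega_chevalley.
have [_ alpha_basis root_pos] := alpha_simple.
have alpha_free := basis_free alpha_basis.
have [_ e_root _ [e_span e_indep]] := e_basis.
have rootN (a : dual H) : is_root a -> is_root (- a) by apply: root_opp.
have indexP (a : dual H) :
    is_root a <-> pos_root alpha a \/ pos_root alpha (- a).
  split=> [ra|[[]|[/rootN]]] //; last by rewrite opprK.
  by have [a_pos|a_neg] := root_pos a ra; [left|right]; split=> //; apply: rootN.
have pos_addr_neq0 (a b : dual H) :
    pos_root alpha a -> pos_root alpha b -> a + b != 0.
  move=> [[a0 _] a_pos] [_ b_pos]; apply/eqP => ab0.
  by rewrite (nat_comb_addr_eq0 alpha_free a_pos b_pos ab0) eqxx in a0.
have posN (a : dual H) : pos_root alpha a -> pos_root alpha (- a) -> False.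
  by move=> a_pos /(pos_addr_neq0 _ _ a_pos); rewrite subrr eqxx.
have omega_h i :
    omega (coroot B t (tnth alpha i)) = - coroot B t (tnth alpha i).
  by apply: omegaH; apply: memvZ; case: (t_dual (tnth alpha i)).
have [S [S_uniq SP]] := lin_indep_enum e_indep.
have [s [s_uniq sP]] :
    exists s, uniq s /\ forall a, a \in s <-> pos_root alpha a.
  (* The positive roots are extracted from the enumeration [S] of the Chevalley indices: [rt] drops
     the Cartan indices. *)
  pose rt (i : 'I_r + dual H) := if i is inr a then Some a else None.
  exists [seq a <- undup (pmap rt S) | `[< pos_root alpha a >]].
  split; first by rewrite filter_uniq ?undup_uniq.
  move=> a; rewrite mem_filter mem_undup; split=> [/andP[/asboolP]//|a_pos].
  apply/andP; split; first exact/asboolP.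
  rewrite mem_pmap; apply/mapP; exists (inr a) => //.
  by apply/SP; case: a_pos.
(* Over the complex numbers the Chevalley basis spans [g], so the span condition on fixed points is
   vacuous. *)
have k_basis : is_basis (pos_root alpha) y (fun x => x \in k).
  have [y_span y_indep] := fixed_points_basis (omega := omega) (fun _ => I)
    indexP posN s_uniq sP omega_h omega_e e_indep.
  split=> // x; split=> [/fixedSpaceP x_fix|/y_span[_ x_fix]].
    by apply/y_span; split=> //; apply/e_span.
  exact/fixedSpaceP.
(* The same map, seen as linear over the integers, lets [fixed_points_basis] apply to the integral
   span. *)
have omegaZ_linear :
    GRing.linear_for *:%R (omega : zmodule g -> zmodule g).
  by move=> n u v; rewrite !scalezrE raddfD raddfMz.
pose omegaZ : {linear zmodule g -> zmodule g} :=
  HB.pack (omega : zmodule g -> zmodule g)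
    (GRing.isLinear.Build int (zmodule g) (zmodule g) *:%R
      (omega : zmodule g -> zmodule g) omegaZ_linear).
have kZ_basis : @is_basis int (zmodule g) _ (pos_root alpha) y kZ.
  exact: (fixed_points_basis (V := zmodule g) (omega := omegaZ) (fun _ => I)
    indexP posN s_uniq sP omega_h omega_e (lin_indep_int e_indep)).
have lie_y (a b : dual H) : pos_root alpha a -> pos_root alpha b -> a != b ->
    [lie y a, y b] = y (a + b) *~ kappa a b - y (a - b) *~ kappa a (- b).
  move=> a_pos b_pos ab; apply: (lie_y_elt omegaM) => //.
  - by case: a_pos.
  - by case: b_pos.
  - exact: pos_addr_neq0.
  - by rewrite subr_eq0.
split=> //; have [kZP _] := kZ_basis.
have kZ0 : kZ 0 by apply/kZP/in_span0.
have kZB u v : kZ u -> kZ v -> kZ (u - v).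
  by rewrite !kZP; apply: (@in_spanB int (zmodule g) _ _ _ s).
have kZMz u n : kZ u -> kZ (u *~ n).
  move=> /kZP[s' [c [s'P ->]]]; apply/kZP; exists s', (fun i => n * c i).
  split=> //; rewrite -scalezrE scaler_sumr.
  by apply: eq_bigr => i _; rewrite scalerA.
have kZy a : is_root a -> kZ (y a).
  move=> /indexP[a_pos|a_neg].
    by apply/kZP; apply: (@in_span_id int (zmodule g)).
  have -> : y a = - y (- a) by rewrite /y /y_elt opprK opprB.
  rewrite -sub0r; apply: kZB => //.
  by apply/kZP; apply: (@in_span_id int (zmodule g)).
(* When [a + b] is not a root, [y (a + b)] is uncontrolled, but its coefficient vanishes. *)
have kZ_kappa a b : kZ (y (a + b) *~ kappa a b).
  have [rab|nab] := pselect (is_root (a + b)); first exact/kZMz/kZy.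
  by have [_ -> //] := kappa_e; rewrite mulr0z.
split=> //.
- exact: lie_fixedSpace.
- by move=> x [_ /fixedSpaceP].
(* Additivity in each argument reduces closure to brackets of basis elements; equal indices, which
   the formula excludes, give 0. *)
- move=> u v /kZP u_span /kZP v_span.
  apply: (in_span_int_ind (Q := fun u => kZ [lie u, v])) u_span.
  + by rewrite lie0l.
  + by move=> u1 u2 ku1 ku2; rewrite lieDl lieNl; apply: kZB.
  move=> a a_pos.
  apply: (in_span_int_ind (Q := fun v => kZ [lie y a, v])) v_span.
  + by rewrite lie0r.
  + by move=> v1 v2 kv1 kv2; rewrite lieDr lieNr; apply: kZB.
  move=> b b_pos; have [->|ab] := eqVneq a b; first by rewrite lie_alternating.
  by rewrite lie_y //; apply: kZB.
- exact: scalar_extension_basis kZ_basis k_basis.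
Qed.
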